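(* Let $\mathbb{K}$ be a field of characteristic $0$, let $k\geq 1$ be an integer, and let $sl_2=sl_2(\mathbb{K})$ be endowed with the $\mathbb{Z}_2$-grading $L_0=\mathbb{K}h$, $L_1=\mathbb{K}e\oplus\mathbb{K}f$. Then $$\mathrm{GKdim}_k^{\mathbb{Z}_2}(sl_2)=3k-1.$$
   Context: $sl_2=sl_2(\mathbb{K})$ is the Lie algebra of traceless $2\times 2$ matrices over $\mathbb{K}$, with standard basis $h=\begin{pmatrix}1&0\\0&-1\end{pmatrix}$, $e=\begin{pmatrix}0&1\\0&0\end{pmatrix}$, $f=\begin{pmatrix}0&0\\1&0\end{pmatrix}$. For an abelian group $G$ and a $G$-graded Lie algebra $L=\bigoplus_{g\in G}L_g$ over $\mathbb{K}$ with finite support $\mathrm{Supp}(L)=\{g\in G: L_g\neq 0\}=\{g_1,\ldots,g_s\}$: let $\mathcal{L}(X)$ be the free $G$-graded Lie algebra over $\mathbb{K}$ on $X=\bigcup_{g\in G}X_g$, where the $X_g=\{x_i^g : i\geq 1\}$ are disjoint infinite sets of variables of homogeneous degree $g$. A polynomial $f\in\mathcal{L}(X)$ is a $G$-graded polynomial identity of $L$ if it vanishes under every substitution of the variables $x_i^g$ by elements of $L_g$ (all $g\in G$, $i\ge 1$); $T_G(L)$ is the ideal of all $G$-graded polynomial identities of $L$. The relatively free $G$-graded algebra of $L$ in $k$ variables is $$\mathcal{L}_k^G(L)=\frac{\mathcal{L}(x_1^{g_1},\ldots,x_k^{g_1},\ldots,x_1^{g_s},\ldots,x_k^{g_s})}{\mathcal{L}(x_1^{g_1},\ldots,x_k^{g_1},\ldots,x_1^{g_s},\ldots,x_k^{g_s})\cap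 T_G(L)},$$ where $\mathcal{L}(x_1^{g_1},\ldots,x_k^{g_s})$ denotes the free Lie algebra on the listed $sk$ variables. For an algebra $A$ generated by a finite set $V$, the growth function $g_V(m)$ is the dimension of the span of all words of length at most $m$ in the elements of $V$, and $\mathrm{GKdim}(A)=\limsup_{m\to\infty}\frac{\ln g_V(m)}{\ln m}$ (independent of $V$). The $G$-graded Gelfand-Kirillov dimension of $L$ in $k$ variables is $\mathrm{GKdim}_k^G(L):=\mathrm{GKdim}(\mathcal{L}_k^G(L))$. *)

(* Defs.v *)
From HB Require Import structures.
From mathcomp Require Import all_boot all_order all_algebra.
From mathcomp Require Import all_classical all_reals all_analysis.
From mathcomp Require Import ring.

Set Implicit Arguments.
Unset Strict Implicit.
Unset Printing Implicit Defensive.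

Import Order.TTheory GRing.Theory Num.Theory.
Local Open Scope classical_set_scope.
Local Open Scope quotient_scope.
Local Open Scope ring_scope.

HB.mixin Record Lmodule_isLie (K : fieldType) L of GRing.Lmodule K L := {
  lie_br : L -> L -> L;
  lie_br_linl : forall y, linear (fun x => lie_br x y);
  lie_br_linr : forall x, linear (lie_br x);
  lie_brxx : forall x, lie_br x x = 0;
  lie_jacobi : forall x y z,
    lie_br x (lie_br y z) + lie_br y (lie_br z x) + lie_br z (lie_br x y) = 0
}.

#[short(type="lieAlgType")]
HB.structure Definition LieAlgebra (K : fieldType) :=
  {L of GRing.Lmodule K L & Lmodule_isLie K L}.

Notation "'[lie' x , y ]" := (lie_br x y)
  (at level 0, x at level 99, y at level 99) : ring_scope.

Section LieTheory.
Variables (K : fieldType) (L : lieAlgType K).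
Implicit Types (x y z : L) (a : K).

Lemma lie_brDl x y z : [lie x + y, z] = [lie x, z] + [lie y, z].
Proof. by have := lie_br_linl z 1 x y; rewrite /= !scale1r. Qed.

Lemma lie_brDr x y z : [lie x, y + z] = [lie x, y] + [lie x, z].
Proof. by have := lie_br_linr x 1 y z; rewrite /= !scale1r. Qed.

Lemma lie_br0l x : [lie 0, x] = 0.
Proof. by apply: (addrI [lie 0, x]); rewrite -lie_brDl !addr0. Qed.

Lemma lie_br0r x : [lie x, 0] = 0.
Proof. by apply: (addrI [lie x, 0]); rewrite -lie_brDr !addr0. Qed.

Lemma lie_brZl a x y : [lie a *: x, y] = a *: [lie x, y].
Proof. by have := lie_br_linl y a x 0; rewrite /= lie_br0l !addr0. Qed.

Lemma lie_brZr a x y : [lie x, a *: y] = a *: [lie x, y].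
Proof. by have := lie_br_linr x a y 0; rewrite /= lie_br0r !addr0. Qed.

Lemma lie_brNl x y : [lie - x, y] = - [lie x, y].
Proof. by rewrite -scaleN1r lie_brZl scaleN1r. Qed.

Lemma lie_brNr x y : [lie x, - y] = - [lie x, y].
Proof. by rewrite -scaleN1r lie_brZr scaleN1r. Qed.

Lemma lie_brC x y : [lie x, y] = - [lie y, x].
Proof.
apply/eqP; rewrite -addr_eq0; have := lie_brxx (x + y).
by rewrite lie_brDl !lie_brDr !lie_brxx addr0 add0r => ->.
Qed.

End LieTheory.

Definition submodule (K : fieldType) (V : lmodType K) (U : set V) : Prop :=
  U 0 /\ forall (a : K) u v, U u -> U v -> U (a *: u + v).

Record lie_ideal (K : fieldType) (L : lieAlgType K) := LieIdeal {
  ideal_set :> L -> Prop;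
  ideal_submod : submodule ideal_set;
  ideal_brl : forall x y, ideal_set y -> ideal_set [lie x, y]
}.

Section LieQuotient.
Variables (K : fieldType) (L : lieAlgType K) (I : lie_ideal L).

Let I0 : I 0. Proof. by case: (ideal_submod I). Qed.
Let ID x y : I x -> I y -> I (x + y).
Proof.
by move=> Ix Iy; case: (ideal_submod I) => _ /(_ 1 x y Ix Iy); rewrite scale1r.
Qed.
Let IZ a x : I x -> I (a *: x).
Proof.
by move=> Ix; case: (ideal_submod I) => _ /(_ a x 0 Ix I0); rewrite addr0.
Qed.
Let IN x : I x -> I (- x). Proof. by rewrite -scaleN1r; exact: IZ. Qed.
Let IBl x y : I y -> I [lie x, y]. Proof. exact: ideal_brl. Qed.
Let IBr x y : I x -> I [lie x, y].
Proof. by move=> Ix; rewrite lie_brC; apply/IN/IBl. Qed.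

Definition ideal_equiv (x y : L) : bool := `[< I (x - y) >].

Lemma ideal_equiv_refl : reflexive ideal_equiv.
Proof. by move=> x; apply/asboolP; rewrite subrr. Qed.

Lemma ideal_equiv_sym : symmetric ideal_equiv.
Proof.
by move=> x y; apply/asboolP/asboolP => h; rewrite -opprB; exact: IN.
Qed.

Lemma ideal_equiv_trans : transitive ideal_equiv.
Proof.
move=> y x z /asboolP h1 /asboolP h2; apply/asboolP.
by rewrite -(subrKA y); exact: ID.
Qed.

Canonical ideal_equiv_rel :=
  EquivRel ideal_equiv ideal_equiv_refl ideal_equiv_sym ideal_equiv_trans.

Definition lie_quot : Type := {eq_quot ideal_equiv_rel}.
HB.instance Definition _ := Choice.on lie_quot.

Definition lie_proj (x : L) : lie_quot := \pi_({eq_quot ideal_equiv_rel}) x.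
Definition lie_lift (u : lie_quot) : L := repr (u : {eq_quot ideal_equiv_rel}).

Lemma lie_projP x y : lie_proj x = lie_proj y <-> I (x - y).
Proof.
rewrite /lie_proj; split => [/eqmodP/asboolP //|h].
by apply/eqmodP/asboolP.
Qed.

Lemma lie_liftK u : lie_proj (lie_lift u) = u.
Proof. exact: reprK. Qed.

Lemma lie_projK x : I (lie_lift (lie_proj x) - x).
Proof. by apply/lie_projP; rewrite lie_liftK. Qed.

Definition lq_add u v := lie_proj (lie_lift u + lie_lift v).
Definition lq_opp u := lie_proj (- lie_lift u).
Definition lq_scale (a : K) u := lie_proj (a *: lie_lift u).
Definition lq_br u v := lie_proj [lie lie_lift u, lie_lift v].

Lemma lq_addE x y : lq_add (lie_proj x) (lie_proj y) = lie_proj (x + y).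
Proof.
by apply/lie_projP; rewrite opprD addrACA; apply: ID; exact: lie_projK.
Qed.

Lemma lq_oppE x : lq_opp (lie_proj x) = lie_proj (- x).
Proof. by apply/lie_projP; rewrite -opprD; apply/IN/lie_projK. Qed.

Lemma lq_scaleE a x : lq_scale a (lie_proj x) = lie_proj (a *: x).
Proof. by apply/lie_projP; rewrite -scalerBr; apply/IZ/lie_projK. Qed.

Lemma lq_brE x y : lq_br (lie_proj x) (lie_proj y) = lie_proj [lie x, y].
Proof.
apply/lie_projP; set x' := lie_lift _; set y' := lie_lift _.
have -> : [lie x', y'] - [lie x, y] = [lie x' - x, y'] + [lie x, y' - y].
  by rewrite lie_brDl lie_brDr lie_brNl lie_brNr subrKA.
by apply: ID; [apply/IBr/lie_projK|apply/IBl/lie_projK].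
Qed.

Let lqE := (lq_addE, lq_oppE, lq_scaleE, lq_brE).

Lemma lie_proj_ind (P : lie_quot -> Prop) : (forall x, P (lie_proj x)) ->
  forall u, P u.
Proof. by move=> h u; rewrite -(lie_liftK u). Qed.

Fact lq_addA : associative lq_add.
Proof. by do 3 elim/lie_proj_ind => ?; rewrite !lqE addrA. Qed.
Fact lq_addC : commutative lq_add.
Proof. by do 2 elim/lie_proj_ind => ?; rewrite !lqE addrC. Qed.
Fact lq_add0 : left_id (lie_proj 0) lq_add.
Proof. by elim/lie_proj_ind => ?; rewrite !lqE add0r. Qed.
Fact lq_addN : left_inverse (lie_proj 0) lq_opp lq_add.
Proof. by elim/lie_proj_ind => ?; rewrite !lqE addNr. Qed.
HB.instance Definition _ :=
  GRing.isZmodule.Build lie_quot lq_addA lq_addC lq_add0 lq_addN.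

Lemma lie_projD x y : lie_proj (x + y) = lie_proj x + lie_proj y.
Proof. by rewrite -[RHS]/(lq_add _ _) lqE. Qed.

Fact lq_scaleA a b v : lq_scale a (lq_scale b v) = lq_scale (a * b) v.
Proof. by elim/lie_proj_ind: v => ?; rewrite !lqE scalerA. Qed.
Fact lq_scale1 : left_id 1 lq_scale.
Proof. by elim/lie_proj_ind => ?; rewrite !lqE scale1r. Qed.
Fact lq_scaleDr : right_distributive lq_scale +%R.
Proof.
move=> a; do 2 elim/lie_proj_ind => ?.
by rewrite -lie_projD !lqE scalerDr lie_projD.
Qed.
Fact lq_scaleDl v : {morph lq_scale^~ v : a b / a + b}.
Proof. by elim/lie_proj_ind: v => ? a b; rewrite !lqE scalerDl lie_projD. Qed.
HB.instance Definition _ := GRing.Zmodule_isLmodule.Build K lie_quot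
  lq_scaleA lq_scale1 lq_scaleDr lq_scaleDl.

Lemma lie_projZ a x : lie_proj (a *: x) = a *: lie_proj x.
Proof. by rewrite -[RHS]/(lq_scale _ _) lqE. Qed.

Lemma lie_proj_is_linear : linear lie_proj.
Proof. by move=> a x y; rewrite lie_projD lie_projZ. Qed.
HB.instance Definition _ :=
  GRing.isLinear.Build K L lie_quot _ lie_proj lie_proj_is_linear.

Fact lq_br_linl v : linear (fun u => lq_br u v).
Proof.
elim/lie_proj_ind: v => z a; do 2 elim/lie_proj_ind => ?.
by rewrite -linearP !lqE lie_br_linl linearP.
Qed.
Fact lq_br_linr u : linear (lq_br u).
Proof.
elim/lie_proj_ind: u => z a; do 2 elim/lie_proj_ind => ?.
by rewrite -linearP !lqE lie_br_linr linearP.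
Qed.
Fact lq_brxx u : lq_br u u = 0.
Proof. by elim/lie_proj_ind: u => x; rewrite lqE lie_brxx. Qed.
Fact lq_jacobi u v w :
  lq_br u (lq_br v w) + lq_br v (lq_br w u) + lq_br w (lq_br u v) = 0.
Proof.
elim/lie_proj_ind: u => x; elim/lie_proj_ind: v => y; elim/lie_proj_ind: w => z.
by rewrite !lqE -!lie_projD lie_jacobi.
Qed.
HB.instance Definition _ := Lmodule_isLie.Build K lie_quot
  lq_br_linl lq_br_linr lq_brxx lq_jacobi.

Lemma lie_proj_br x y : lie_proj [lie x, y] = [lie lie_proj x, lie_proj y].
Proof. by rewrite -lq_brE. Qed.

Lemma lie_proj_eq0 x : lie_proj x = 0 <-> I x.
Proof. by rewrite -{2}(subr0 x) -lie_projP. Qed.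

End LieQuotient.

Section LieTerms.
Variables (K : fieldType) (X : Type).

Inductive lie_term : Type :=
| TVar of X
| TZero
| TAdd of lie_term & lie_term
| TScale of K & lie_term
| TBr of lie_term & lie_term.

HB.instance Definition _ := gen_eqMixin lie_term.
HB.instance Definition _ := gen_choiceMixin lie_term.

(* The least congruence whose quotient is a Lie algebra over K. *)
Inductive lie_cong : lie_term -> lie_term -> Prop :=
| cong_refl s : lie_cong s s
| cong_sym s t : lie_cong s t -> lie_cong t s
| cong_trans s t u : lie_cong s t -> lie_cong t u -> lie_cong s u
| cong_add s s' t t' :
    lie_cong s s' -> lie_cong t t' -> lie_cong (TAdd s t) (TAdd s' t')
| cong_scale a s s' : lie_cong s s' -> lie_cong (TScale a s) (TScale a s')
| cong_br s s' t t' :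
    lie_cong s s' -> lie_cong t t' -> lie_cong (TBr s t) (TBr s' t')
| cong_addA s t u : lie_cong (TAdd s (TAdd t u)) (TAdd (TAdd s t) u)
| cong_addC s t : lie_cong (TAdd s t) (TAdd t s)
| cong_add0 s : lie_cong (TAdd TZero s) s
| cong_addN s : lie_cong (TAdd (TScale (-1) s) s) TZero
| cong_scaleA a b s : lie_cong (TScale a (TScale b s)) (TScale (a * b) s)
| cong_scale1 s : lie_cong (TScale 1 s) s
| cong_scaleDr a s t :
    lie_cong (TScale a (TAdd s t)) (TAdd (TScale a s) (TScale a t))
| cong_scaleDl a b s :
    lie_cong (TScale (a + b) s) (TAdd (TScale a s) (TScale b s))
| cong_brl a s t u : lie_cong (TBr (TAdd (TScale a s) t) u)
                              (TAdd (TScale a (TBr s u)) (TBr t u))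
| cong_brr a s t u : lie_cong (TBr u (TAdd (TScale a s) t))
                              (TAdd (TScale a (TBr u s)) (TBr u t))
| cong_brss s : lie_cong (TBr s s) TZero
| cong_jacobi s t u :
    lie_cong (TAdd (TAdd (TBr s (TBr t u)) (TBr t (TBr u s))) (TBr u (TBr s t)))
             TZero.

Definition lie_congb (s t : lie_term) : bool := `[< lie_cong s t >].

Lemma lie_congb_refl : reflexive lie_congb.
Proof. by move=> s; apply/asboolP; exact: cong_refl. Qed.

Lemma lie_congb_sym : symmetric lie_congb.
Proof. by move=> s t; apply/asboolP/asboolP; exact: cong_sym. Qed.

Lemma lie_congb_trans : transitive lie_congb.
Proof.
by move=> t s u /asboolP h1 /asboolP h2; apply/asboolP; exact: cong_trans h2.
Qed.

Canonical lie_cong_rel :=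
  EquivRel lie_congb lie_congb_refl lie_congb_sym lie_congb_trans.

End LieTerms.

Arguments TVar {K X}.
Arguments TZero {K X}.

Section FreeLie.
Variables (K : fieldType) (X : Type).
Local Notation term := (lie_term K X).

Definition free_lie : Type := {eq_quot (lie_cong_rel K X)}.
HB.instance Definition _ := Choice.on free_lie.

Definition fl_class (s : term) : free_lie := \pi_({eq_quot lie_cong_rel K X}) s.
Definition fl_repr (u : free_lie) : term := repr (u : {eq_quot lie_cong_rel K X}).

Lemma fl_classP s t : fl_class s = fl_class t <-> lie_cong s t.
Proof.
rewrite /fl_class; split => [/eqmodP/asboolP //|h].
by apply/eqmodP/asboolP.
Qed.

Lemma fl_reprK u : fl_class (fl_repr u) = u.
Proof. exact: reprK. Qed.

Lemma fl_classK s : lie_cong (fl_repr (fl_class s)) s.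
Proof. by apply/fl_classP; rewrite fl_reprK. Qed.

Definition fl_add u v := fl_class (TAdd (fl_repr u) (fl_repr v)).
Definition fl_scale a u := fl_class (TScale a (fl_repr u)).
Definition fl_opp u := fl_scale (-1) u.
Definition fl_br u v := fl_class (TBr (fl_repr u) (fl_repr v)).

Lemma fl_addE s t : fl_add (fl_class s) (fl_class t) = fl_class (TAdd s t).
Proof. by apply/fl_classP/cong_add; exact: fl_classK. Qed.

Lemma fl_scaleE a s : fl_scale a (fl_class s) = fl_class (TScale a s).
Proof. by apply/fl_classP/cong_scale; exact: fl_classK. Qed.

Lemma fl_brE s t : fl_br (fl_class s) (fl_class t) = fl_class (TBr s t).
Proof. by apply/fl_classP/cong_br; exact: fl_classK. Qed.

Let flE := (fl_addE, fl_scaleE, fl_brE).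

Lemma fl_class_ind (P : free_lie -> Prop) : (forall s, P (fl_class s)) ->
  forall u, P u.
Proof. by move=> h u; rewrite -(fl_reprK u). Qed.

Fact fl_addA : associative fl_add.
Proof. by do 3 elim/fl_class_ind => ?; rewrite !flE; exact/fl_classP/cong_addA. Qed.
Fact fl_addC : commutative fl_add.
Proof. by do 2 elim/fl_class_ind => ?; rewrite !flE; exact/fl_classP/cong_addC. Qed.
Fact fl_add0 : left_id (fl_class TZero) fl_add.
Proof. by elim/fl_class_ind => ?; rewrite !flE; exact/fl_classP/cong_add0. Qed.
Fact fl_addN : left_inverse (fl_class TZero) fl_opp fl_add.
Proof.
by elim/fl_class_ind => ?; rewrite /fl_opp !flE; exact/fl_classP/cong_addN.
Qed.
HB.instance Definition _ :=
  GRing.isZmodule.Build free_lie fl_addA fl_addC fl_add0 fl_addN.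

Lemma fl_classD s t : fl_class (TAdd s t) = fl_class s + fl_class t.
Proof. by rewrite -[RHS]/(fl_add _ _) flE. Qed.

Fact fl_scaleA a b u : fl_scale a (fl_scale b u) = fl_scale (a * b) u.
Proof. by elim/fl_class_ind: u => ?; rewrite !flE; exact/fl_classP/cong_scaleA. Qed.
Fact fl_scale1 : left_id 1 fl_scale.
Proof. by elim/fl_class_ind => ?; rewrite !flE; exact/fl_classP/cong_scale1. Qed.
Fact fl_scaleDr : right_distributive fl_scale +%R.
Proof.
move=> a; do 2 elim/fl_class_ind => ?; rewrite -fl_classD !flE -fl_classD.
exact/fl_classP/cong_scaleDr.
Qed.
Fact fl_scaleDl u : {morph fl_scale^~ u : a b / a + b}.
Proof.
elim/fl_class_ind: u => ? a b; rewrite !flE -fl_classD.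
exact/fl_classP/cong_scaleDl.
Qed.
HB.instance Definition _ := GRing.Zmodule_isLmodule.Build K free_lie
  fl_scaleA fl_scale1 fl_scaleDr fl_scaleDl.

Lemma fl_classZ a s : fl_class (TScale a s) = a *: fl_class s.
Proof. by rewrite -[RHS]/(fl_scale _ _) flE. Qed.

Fact fl_br_linl v : linear (fun u => fl_br u v).
Proof.
elim/fl_class_ind: v => t a; elim/fl_class_ind => s; elim/fl_class_ind => s'.
rewrite -fl_classZ -fl_classD !flE -fl_classZ -fl_classD.
exact/fl_classP/cong_brl.
Qed.
Fact fl_br_linr u : linear (fl_br u).
Proof.
elim/fl_class_ind: u => t a; elim/fl_class_ind => s; elim/fl_class_ind => s'.
rewrite -fl_classZ -fl_classD !flE -fl_classZ -fl_classD.
exact/fl_classP/cong_brr.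
Qed.
Fact fl_brxx u : fl_br u u = 0.
Proof. by elim/fl_class_ind: u => ?; rewrite flE; exact/fl_classP/cong_brss. Qed.
Fact fl_jacobi u v w :
  fl_br u (fl_br v w) + fl_br v (fl_br w u) + fl_br w (fl_br u v) = 0.
Proof.
elim/fl_class_ind: u => ?; elim/fl_class_ind: v => ?; elim/fl_class_ind: w => ?.
by rewrite !flE -!fl_classD; exact/fl_classP/cong_jacobi.
Qed.
HB.instance Definition _ := Lmodule_isLie.Build K free_lie
  fl_br_linl fl_br_linr fl_brxx fl_jacobi.

Lemma fl_class_br s t : fl_class (TBr s t) = [lie fl_class s, fl_class t].
Proof. by rewrite -fl_brE. Qed.

Definition fl_var (x : X) : free_lie := fl_class (TVar x).

End FreeLie.

(* [lie_eval v] is the unique Lie algebra morphism sending each variable x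
   to v x; see [lie_eval_var], [lie_evalP], [lie_eval_br]. *)
Section Evaluation.
Variables (K : fieldType) (X : Type) (L : lieAlgType K) (v : X -> L).

Fixpoint term_eval (s : lie_term K X) : L :=
  match s with
  | TVar x => v x
  | TZero => 0
  | TAdd s t => term_eval s + term_eval t
  | TScale a s => a *: term_eval s
  | TBr s t => [lie term_eval s, term_eval t]
  end.

Lemma term_eval_cong s t : lie_cong s t -> term_eval s = term_eval t.
Proof.
elim=> //=.
- by move=> ? ? ? _ -> _ ->.
- by move=> ? ? ? ? _ -> _ ->.
- by move=> ? ? ? _ ->.
- by move=> ? ? ? ? _ -> _ ->.
- by move=> *; rewrite addrA.
- by move=> *; rewrite addrC.
- by move=> *; rewrite add0r.
- by move=> *; rewrite scaleN1r addNr.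
- by move=> *; rewrite scalerA.
- by move=> *; rewrite scale1r.
- by move=> *; rewrite scalerDr.
- by move=> *; rewrite scalerDl.
- by move=> *; rewrite lie_brDl lie_brZl.
- by move=> *; rewrite lie_brDr lie_brZr.
- by move=> *; rewrite lie_brxx.
- by move=> *; rewrite lie_jacobi.
Qed.

Definition lie_eval (u : free_lie K X) : L := term_eval (fl_repr u).

Lemma lie_eval_class s : lie_eval (fl_class s) = term_eval s.
Proof. exact/term_eval_cong/fl_classK. Qed.

Lemma lie_eval_var x : lie_eval (fl_var K x) = v x.
Proof. exact: lie_eval_class. Qed.

Lemma lie_evalP : linear lie_eval.
Proof.
move=> a; elim/fl_class_ind => s; elim/fl_class_ind => t.
by rewrite -fl_classZ -fl_classD !lie_eval_class.
Qed.
HB.instance Definition _ :=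
  GRing.isLinear.Build K (free_lie K X) L _ lie_eval lie_evalP.

Lemma lie_eval_br u w : lie_eval [lie u, w] = [lie lie_eval u, lie_eval w].
Proof.
elim/fl_class_ind: u => s; elim/fl_class_ind: w => t.
by rewrite -fl_class_br !lie_eval_class.
Qed.

End Evaluation.

Record lie_grading (K : fieldType) (G : zmodType) (L : lieAlgType K) :=
  LieGrading {
  homog :> G -> set L;
  homog_submod : forall g, submodule (homog g);
  homog_br : forall g h x y, homog g x -> homog h y -> homog (g + h) [lie x, y];
  homog_span : forall x, exists (s : seq G) (c : G -> L),
    (forall g, homog g (c g)) /\ x = \sum_(g <- s) c g;
  homog_direct : forall (s : seq G) (c : G -> L), uniq s ->
    (forall g, homog g (c g)) -> \sum_(g <- s) c g = 0 ->
    forall g, g \in s -> c g = 0;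
  homog_finite : finite_set [set g | homog g <> [set 0]]
}.

Section GradedIdentities.
Variables (K : fieldType) (G : zmodType) (L : lieAlgType K).
Variable Lg : lie_grading G L.

Definition grading_supp : set G := [set g | Lg g <> [set 0]].

(* The variable (g, i) is the variable of degree g and index i + 1. *)
Definition graded_identities : set (free_lie K (G * nat)%type) :=
  [set f | forall v : G * nat -> L,
             (forall g i, Lg g (v (g, i))) -> lie_eval v f = 0].

Lemma graded_identities_submod : submodule graded_identities.
Proof.
split=> [v _|a u w hu hw v hv]; first by rewrite linear0.
by rewrite linearP /= hu // hw // scaler0 addr0.
Qed.

Lemma graded_identities_brl u w :
  graded_identities w -> graded_identities [lie u, w].
Proof. by move=> hw v hv; rewrite lie_eval_br hw // lie_br0r. Qed.

Definition T_ideal : lie_ideal (free_lie K (G * nat)%type) :=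
  LieIdeal graded_identities_submod graded_identities_brl.

Variable k : nat.

Definition k_var : Type := ({g : G | `[< grading_supp g >]} * 'I_k)%type.

Definition k_incl : free_lie K k_var -> free_lie K (G * nat)%type :=
  lie_eval (fun x : k_var => fl_var K (val x.1, val x.2)).

(* The intersection of T_G(L) with the free Lie algebra on the listed variables,
   seen inside the free Lie algebra on all variables through [k_incl]. *)
Definition k_identities : set (free_lie K k_var) := [set u | T_ideal (k_incl u)].

Lemma k_identities_submod : submodule k_identities.
Proof.
have [T0 TD] := ideal_submod T_ideal.
split=> [|a u w hu hw]; rewrite /k_identities /mkset /k_incl.
  by rewrite linear0.
by rewrite linearP; exact: TD.
Qed.

Lemma k_identities_brl u w : k_identities w -> k_identities [lie u, w].
Proof.
by rewrite /k_identities /mkset /k_incl lie_eval_br => /ideal_brl; exact.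
Qed.

Definition k_ideal : lie_ideal (free_lie K k_var) :=
  LieIdeal k_identities_submod k_identities_brl.

Definition rel_free : lieAlgType K := lie_quot k_ideal.

Definition rel_free_gens : set rel_free :=
  range (fun x : k_var => lie_proj k_ideal (fl_var K x)).

End GradedIdentities.

Arguments rel_free {K G L} Lg k.
Arguments rel_free_gens {K G L} Lg k _.

Section Dimension.
Variables (K : fieldType) (V : lmodType K).

Definition lspan (S : set V) : set V :=
  [set u | exists n (c : 'I_n -> K) (w : 'I_n -> V),
             (forall i, S (w i)) /\ u = \sum_i c i *: w i].

Definition lin_indep n (b : 'I_n -> V) : Prop :=
  forall c : 'I_n -> K, \sum_i c i *: b i = 0 -> forall i, c i = 0.

(* The dimension of a finite-dimensional subspace (0 if there is no finite
   basis). *)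
Definition ldim (U : set V) : nat :=
  xget 0%N [set n | exists b : 'I_n -> V, lin_indep b /\ lspan (range b) = U].

End Dimension.

Section Growth.
Variables (R : realType) (K : fieldType) (A : lieAlgType K) (V : set A).

(* Words are arbitrarily bracketed products of elements of V. *)
Inductive word_length : nat -> A -> Prop :=
| word_gen x : V x -> word_length 1 x
| word_br m n x y :
    word_length m x -> word_length n y -> word_length (m + n) [lie x, y].

Definition growth (m : nat) : nat :=
  ldim (lspan [set w | exists2 n, (n <= m)%N & word_length n w]).

(* V is meant to be a finite generating set of A; the value is then independent
   of V. ln is 0 at 0 and x / 0 is 0, so the terms m = 0 and m = 1 are junk,
   which the limsup ignores. *)
Definition GKdim : \bar R :=
  limn_esup (fun m => (ln (growth m)%:R / ln m%:R)%:E).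

End Growth.

Definition graded_GKdim (R : realType) (K : fieldType) (G : zmodType)
    (L : lieAlgType K) (Lg : lie_grading G L) (k : nat) : \bar R :=
  GKdim R (rel_free_gens Lg k).

Section Sl2.
Variable K : fieldType.

Definition traceless : {pred 'M[K]_2} := [pred A | \tr A == 0].

Fact traceless_submod : submod_closed traceless.
Proof.
split=> [|a A B]; rewrite !inE ?mxtrace0 // => /eqP hA /eqP hB.
by rewrite linearP /= hA hB mulr0 addr0.
Qed.
HB.instance Definition _ := GRing.isSubmodClosed.Build K 'M[K]_2 traceless
  (GRing.submod_closed_semi traceless_submod).

Record sl2 := Sl2 { sl2_val :> 'M[K]_2; _ : sl2_val \in traceless }.
HB.instance Definition _ := [isSub for sl2_val].
HB.instance Definition _ := [Choice of sl2 by <:].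
HB.instance Definition _ := [SubChoice_isSubLmodule of sl2 by <:].

Implicit Types x y z : sl2.

Fact sl2_br_subproof x y :
  (x : 'M[K]_2) *m y - (y : 'M[K]_2) *m x \in traceless.
Proof. by rewrite !inE raddfB /= mxtrace_mulC subrr. Qed.
Definition sl2_br x y : sl2 := Sl2 (sl2_br_subproof x y).

Lemma sl2_valZ a x : sl2_val (a *: x) = a *: sl2_val x.
Proof. by []. Qed.

Lemma sl2_valD x y : sl2_val (x + y) = sl2_val x + sl2_val y.
Proof. by []. Qed.

Fact sl2_br_linl y : linear (fun x => sl2_br x y).
Proof.
move=> a x x'; apply: val_inj => /=.
by rewrite mulmxDl mulmxDr -scalemxAl -scalemxAr scalerBr opprD addrACA.
Qed.
Fact sl2_br_linr x : linear (sl2_br x).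
Proof.
move=> a y y'; apply: val_inj => /=.
by rewrite mulmxDl mulmxDr -scalemxAl -scalemxAr scalerBr opprD addrACA.
Qed.
Fact sl2_brxx x : sl2_br x x = 0.
Proof. by apply: val_inj; rewrite /= subrr. Qed.
Fact sl2_jacobi x y z :
  sl2_br x (sl2_br y z) + sl2_br y (sl2_br z x) + sl2_br z (sl2_br x y) = 0.
Proof.
apply: val_inj; rewrite !raddfD /= !mulmxBl !mulmxBr !mulmxA.
apply/matrixP => i j; do 6 (set t := _ *m _ *m _; move: t => ?).
rewrite !mxE; ring.
Qed.
HB.instance Definition _ := Lmodule_isLie.Build K sl2
  sl2_br_linl sl2_br_linr sl2_brxx sl2_jacobi.

Fact sl2_h_subproof : delta_mx 0 0 - delta_mx 1 1 \in traceless.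
Proof.
by rewrite inE raddfB /= /mxtrace !big_ord_recl !big_ord0 !mxE /= !addr0 add0r subrr.
Qed.
Fact sl2_e_subproof : delta_mx 0 1 \in traceless.
Proof. by rewrite inE /mxtrace !big_ord_recl !big_ord0 !mxE /= !addr0. Qed.
Fact sl2_f_subproof : delta_mx 1 0 \in traceless.
Proof. by rewrite inE /mxtrace !big_ord_recl !big_ord0 !mxE /= !addr0. Qed.

Definition sl2_h : sl2 := Sl2 sl2_h_subproof.
Definition sl2_e : sl2 := Sl2 sl2_e_subproof.
Definition sl2_f : sl2 := Sl2 sl2_f_subproof.

Lemma sum_ord2 (F : 'I_2 -> K) : \sum_i F i = F 0 + F 1.
Proof.
by rewrite !big_ord_recl big_ord0 addr0; congr (_ + F _); exact: val_inj.
Qed.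

Lemma ord2P (i : 'I_2) : i = 0 \/ i = 1.
Proof. by case: i => [[|[|//]] ?]; [left|right]; exact: val_inj. Qed.

Lemma sl2_11 x : x 1 1 = - x 0 0.
Proof.
have : \tr (sl2_val x) = 0 by apply/eqP; exact: (valP x).
by rewrite /mxtrace sum_ord2 addrC => /addr0_eq <-; rewrite opprK.
Qed.

Lemma sl2_eqP x y : x 0 0 = y 0 0 -> x 0 1 = y 0 1 -> x 1 0 = y 1 0 -> x = y.
Proof.
move=> h00 h01 h10; apply/val_inj/matrixP => i j.
by case: (ord2P i) => ->; case: (ord2P j) => -> //; rewrite !sl2_11 h00.
Qed.

Definition sl2_homog (g : 'Z_2) : set sl2 :=
  if g == 0 then [set x | exists a : K, x = a *: sl2_h]
  else [set x | exists a b : K, x = a *: sl2_e + b *: sl2_f].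

Fact sl2_homog_submod g : submodule (sl2_homog g).
Proof.
rewrite /sl2_homog; case: ifP => _; split=> /=.
- by exists 0; rewrite scale0r.
- by move=> c _ _ [a ->] [b ->]; exists (c * a + b); rewrite scalerDl scalerA.
- by exists 0, 0; rewrite !scale0r addr0.
move=> c _ _ [a [b ->]] [a' [b' ->]]; exists (c * a + a'), (c * b + b').
by rewrite scalerDr !scalerDl !scalerA addrACA.
Qed.

Fact sl2_homog0P x : sl2_homog 0 x <-> x 0 1 = 0 /\ x 1 0 = 0.
Proof.
rewrite /sl2_homog eqxx; split=> [[a ->]|[h01 h10]].
  by rewrite sl2_valZ /= !mxE /= !(subrr, mulr0).
exists (x 0 0); apply: sl2_eqP;
  by rewrite sl2_valZ /= !mxE /= ?subr0 ?mulr1 ?mulr0.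
Qed.

Fact sl2_homog1P x : sl2_homog 1 x <-> x 0 0 = 0.
Proof.
rewrite /sl2_homog; split=> [[a [b ->]]|h00].
  by rewrite !(sl2_valD, sl2_valZ) /= !mxE /= !mulr0 addr0.
exists (x 0 1), (x 1 0); apply: sl2_eqP; rewrite !(sl2_valD, sl2_valZ) /=;
  by rewrite !mxE /= ?mulr1 ?mulr0 ?addr0 ?add0r.
Qed.

Fact sl2_homog_br g g' x y :
  sl2_homog g x -> sl2_homog g' y -> sl2_homog (g + g') [lie x, y].
Proof.
have E : (1 + 1 : 'Z_2) = 0 by exact: val_inj.
case: (ord2P g) => ->; case: (ord2P g') => ->; rewrite ?E ?addr0 ?add0r.
- move=> /sl2_homog0P[x1 x2] /sl2_homog0P[y1 y2]; apply/sl2_homog0P.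
  rewrite /= !mxE !sum_ord2 x1 x2 y1 y2; split; ring.
- move=> /sl2_homog0P[x1 x2] /sl2_homog1P y1; apply/sl2_homog1P.
  rewrite /= !mxE !sum_ord2 x1 x2 y1; ring.
- move=> /sl2_homog1P x1 /sl2_homog0P[y1 y2]; apply/sl2_homog1P.
  rewrite /= !mxE !sum_ord2 x1 y1 y2; ring.
move=> /sl2_homog1P x1 /sl2_homog1P y1; apply/sl2_homog0P.
rewrite /= !mxE !sum_ord2 !sl2_11 x1 y1; split; ring.
Qed.

Fact sl2_homog_span x : exists (s : seq 'Z_2) (c : 'Z_2 -> sl2),
  (forall g, sl2_homog g (c g)) /\ x = \sum_(g <- s) c g.
Proof.
exists [:: 0; 1], (fun g => if g == 0 then x 0 0 *: sl2_h
                            else x 0 1 *: sl2_e + x 1 0 *: sl2_f); split.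
  rewrite /sl2_homog => g; case: ifP => _ /=; first by eexists.
  by do 2 eexists.
rewrite !big_cons big_nil addr0 /=.
by apply: sl2_eqP; rewrite !(sl2_valD, sl2_valZ) /=
  !mxE /= ?oppr0 !(mulr0, mulr1, addr0, add0r).
Qed.

Fact sl2_homog_direct (s : seq 'Z_2) (c : 'Z_2 -> sl2) : uniq s ->
  (forall g, sl2_homog g (c g)) -> \sum_(g <- s) c g = 0 ->
  forall g, g \in s -> c g = 0.
Proof.
move=> us hc s0.
have /sl2_homog0P[c01 c02] := hc 0; have /sl2_homog1P c1 := hc 1.
have coef i j : \sum_(g <- s) sl2_val (c g) i j = 0.
  have := congr1 \val s0; rewrite raddf_sum raddf0 => /matrixP/(_ i j).
  by rewrite summxE mxE.
have sum1 (F : 'Z_2 -> K) g : (forall g', g' != g -> F g' = 0) ->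
    \sum_(g' <- s) F g' = 0 -> g \in s -> F g = 0.
  by move=> F0 + gs; rewrite (bigD1_seq g) //= big1 ?addr0.
move=> g; case: (ord2P g) => -> gs; apply: sl2_eqP; rewrite [RHS]mxE //.
- apply: (sum1 (fun g => sl2_val (c g) 0 0)) gs => // g'.
  by case: (ord2P g') => ->.
- apply: (sum1 (fun g => sl2_val (c g) 0 1)) gs => // g'.
  by case: (ord2P g') => ->.
- apply: (sum1 (fun g => sl2_val (c g) 1 0)) gs => // g'.
  by case: (ord2P g') => ->.
Qed.

Fact sl2_homog_finite : finite_set [set g | sl2_homog g <> [set 0]].
Proof. exact: finite_finset. Qed.

Definition sl2_grading : lie_grading 'Z_2 sl2 :=
  LieGrading sl2_homog_submod sl2_homog_br sl2_homog_span sl2_homog_direct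
    sl2_homog_finite.

End Sl2.

(* Main.v *)
Require Import Defs.
From HB Require Import structures.
From mathcomp Require Import all_boot all_order all_algebra.
From mathcomp Require Import all_classical all_reals all_analysis.
From mathcomp Require Import ring zify.

(** The relatively free algebra is the Lie algebra generated, inside the
    [sl2]-valued functions on K^(3k), by the generic elements y_i = t_i h and
    z_i = a_i e + b_i f ([k_identitiesP], [rf_eval_inj]). A point of K^(3k) is
    a function p on ['I_3 * 'I_k], with t_i = p (0, i), a_i = p (1, i) and b_i
    = p (2, i). Put D = 3k - 1; the growth function is shown to lie between
    two multiples of m^D.

    Upper bound.  The torus of SL_2 acts on e, f, a_i, b_i with weights
    1, -1, 1, -1 and fixes h and t_i, in such a way that y_i and z_i are
    combinations of terms (coordinate of weight c) * (basis vector of weight c).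
    Brackets preserve this matching, so a word of length n is a combination of
    monomials times basis vectors in which both weights agree and all exponents
    are at most n ([word_balanced]).  The weight equation determines the
    exponent of some a_i from the other 3k - 1 exponents, which leaves at most
    3 (m + 1)^D monomials ([card_exponents]).

    Lower bound.  On even elements, which are multiples of h, the operators
    [z_0, [z_j, -]] and [z_0, [y_0, [z_j, -]]] are multiplications by
    2 (a_0 b_j + b_0 a_j) and - 4 t_0 (a_0 b_j - b_0 a_j); on the e-coordinate
    of odd elements, [y_i, -] is multiplication by 2 t_i.  Leaving out the
    second operator for j = 0, where it vanishes, there are k + (k - 1) + k = D
    multipliers, and they can be given arbitrary nonzero values by a point with
    a_0 = 1 ([point_with_multipliers]).  Start from y_0, apply the operators of
    the first two kinds, bracket with z_0, and apply those of the third kind: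
    using each operator fewer than s times gives s^D words of length O(s).
    When the i-th multiplier has the value x^(s^i) and the numbers of
    applications are the base-s digits of N < s^D, the e-coordinate of the word
    is x^(N+1) ([odd_word_digits]).  Distinct powers are linearly independent
    functions on an infinite field.

    A function squeezed between multiples of m^D has logarithmic growth rate D
    ([limsup_log_growth]). *)

Import Order.TTheory GRing.Theory Num.Theory.
Local Open Scope ring_scope.

Set Implicit Arguments.
Unset Strict Implicit.
Unset Printing Implicit Defensive.

(** * Spans and dimensions *)

Section Span.
Variables (K : fieldType) (V : lmodType K).
Implicit Types (S U : set V).

Lemma submodule_sum U (I : Type) (r : seq I) (c : I -> K) (w : I -> V) :
  submodule U -> (forall i, U (w i)) -> U (\sum_(i <- r) c i *: w i).
Proof.
case=> U0 UD Uw; elim: r => [|i r IHr]; first by rewrite big_nil.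
by rewrite big_cons; apply: UD.
Qed.

Lemma lspan_sub S u : S u -> lspan S u.
Proof.
move=> Su; exists 1%N, (fun=> 1), (fun=> u).
by split=> //; rewrite big_ord1 scale1r.
Qed.

Lemma lspan_submod S : submodule (lspan S).
Proof.
split=> [|a _ _ [m [c [w [Sw ->]]]] [n [d [x [Sx ->]]]]].
  by exists 0%N, (fun=> 0), (fun=> 0); split=> [[]//|]; rewrite big_ord0.
exists (m + n)%N,
  (fun i => match fintype.split i with inl j => a * c j | inr j => d j end),
  (fun i => match fintype.split i with inl j => w j | inr j => x j end); split.
  by move=> i; case: fintype.split.
rewrite big_split_ord scaler_sumr; congr (_ + _); apply: eq_bigr => i _.
  by rewrite (unsplitK (inl i : 'I_m + 'I_n)) scalerA.
by rewrite (unsplitK (inr i : 'I_m + 'I_n)).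
Qed.

Lemma lspan_min S U : submodule U -> (forall u, S u -> U u) ->
  forall u, lspan S u -> U u.
Proof.
move=> subU SU _ [n [c [w [Sw ->]]]].
by apply: submodule_sum => // i; apply: SU.
Qed.

Lemma lspan_mono S S' u : (forall v, S v -> S' v) -> lspan S u -> lspan S' u.
Proof.
move=> SS'; apply: (lspan_min (lspan_submod S')) => v /SS'; exact: lspan_sub.
Qed.

Lemma lspan_range (J : finType) (g : J -> V) u :
  lspan (range g) u -> exists c : J -> K, u = \sum_j c j *: g j.
Proof.
apply: (lspan_min (U := fun u => exists c : J -> K, u = \sum_j c j *: g j)).
  split=> [|a _ _ [c ->] [d ->]].
    by exists (fun=> 0); rewrite big1 // => j _; rewrite scale0r.
  exists (fun j => a * c j + d j); rewrite scaler_sumr -big_split /=.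
  by apply: eq_bigr => j _; rewrite scalerDl scalerA.
move=> _ [j _ <-]; exists (fun i => (i == j)%:R).
rewrite (bigD1 j) //= eqxx scale1r big1 ?addr0 // => i /negPf->.
by rewrite scale0r.
Qed.

(** Steinitz: coordinates with respect to the family [g] form a matrix with [n]
    rows and [#|J|] columns; if [#|J| < n], its row kernel contains a nonzero
    linear relation. *)
Lemma lin_indep_leq_card n (b : 'I_n -> V) (J : finType) (g : J -> V) :
  lin_indep b -> (forall i, lspan (range g) (b i)) -> (n <= #|J|)%N.
Proof.
move=> bfree bg.
have [C bE] := choice (fun i => lspan_range (bg i)).
pose A := \matrix_(i < n, j < #|J|) C i (enum_val j).
rewrite leqNgt; apply/negP => ltJn.
have : kermx A != 0.
  rewrite kermx_eq0 -row_leq_rank -ltnNge.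
  exact: leq_ltn_trans (rank_leq_col A) ltJn.
move=> /eqP; apply; apply/row_matrixP => l; rewrite row0.
have rA : row l (kermx A) *m A = 0 by rewrite -row_mul mulmx_ker row0.
apply/rowP => i; rewrite [RHS]mxE.
apply: (bfree (fun i => row l (kermx A) 0 i)).
under eq_bigr do rewrite bE scaler_sumr.
rewrite exchange_big big1 //= => j _.
have := congr1 (fun M : 'rV[K]_#|J| => M ord0 (enum_rank j)) rA.
rewrite !mxE => rAj; under eq_bigr do rewrite scalerA.
rewrite -scaler_suml [X in X *: _](_ : _ = 0) ?scale0r // -[RHS]rAj.
by apply: eq_bigr => i' _; rewrite !mxE enum_rankK.
Qed.

Lemma lin_indep_map (W : lmodType K) (f : {linear V -> W}) n (b : 'I_n -> V) :
  (forall u, f u = 0 -> u = 0) -> lin_indep b -> lin_indep (f \o b).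
Proof.
move=> inj_f bfree c /= sum0; apply: bfree; apply: inj_f.
by rewrite linear_sum -[RHS]sum0; apply: eq_bigr => i _; rewrite linearZ.
Qed.

(** A vector of [U] outside the span could be added to the family. *)
Lemma maximal_lin_indep_span U n (b : 'I_n -> V) :
  submodule U -> lin_indep b -> (forall i, U (b i)) ->
  (forall b' : 'I_n.+1 -> V, lin_indep b' -> ~ forall i, U (b' i)) ->
  lspan (range b) = U.
Proof.
move=> subU bfree Ub bmax; apply/seteqP; split=> u.
  by apply: (lspan_min subU) => _ [i _ <-].
move=> Uu; apply: contrapT => nbu.
pose b' (i : 'I_n.+1) := if unlift ord0 i is Some j then b j else u.
apply: (bmax b') => [c|i]; last by rewrite /b'; case: unlift.
rewrite big_ord_recl; under eq_bigr do rewrite /b' liftK.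
rewrite /b' unlift_none => sum0.
have c0 : c ord0 = 0.
  apply/eqP; apply/negPn/negP => nc0; apply: nbu.
  rewrite -[u]scale1r -(mulVf nc0) -scalerA.
  rewrite -[c ord0 *: u]opprK (addr0_eq sum0) -[_ *: _]addr0.
  rewrite -sumrN; under eq_bigr do rewrite -scaleNr.
  have [B0 BD] := lspan_submod (range b); apply: BD => //.
  by apply: submodule_sum (lspan_submod _) _ => i; apply: lspan_sub; exists i.
move: sum0; rewrite c0 scale0r add0r => sum0 i.
by case: (unliftP ord0 i) => [j ->|->] //; apply: (bfree (c \o lift ord0)).
Qed.

(** [ldim] is 0 when no finite basis exists, so a lower bound needs a basis.
    A bound [N] on the size of the independent families provides one: a family
    of maximal size. *)
Lemma ldim_bounds U N :
    submodule U ->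
    (forall n (b : 'I_n -> V), lin_indep b -> (forall i, U (b i)) ->
       (n <= N)%N) ->
  (ldim U <= N)%N /\
  forall n (b : 'I_n -> V), lin_indep b -> (forall i, U (b i)) ->
    (n <= ldim U)%N.
Proof.
move=> subU bndU.
pose P n := `[< exists b : 'I_n -> V, lin_indep b /\ forall i, U (b i) >].
have P0 : exists n, P n.
  by exists 0%N; apply/asboolP; exists (fun=> 0); split=> [c _|] [].
have Pbnd n : P n -> (n <= N)%N.
  by move=> /asboolP[b [bfree Ub]]; apply: bndU bfree Ub.
case: (ex_maxnP P0 Pbnd) => n /asboolP[b [bfree Ub]] nmax.
have spanb : lspan (range b) = U.
  apply: maximal_lin_indep_span => // b' b'free Ub'.
  suff : P n.+1 by move=> /nmax; rewrite ltnn.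
  by apply/asboolP; exists b'.
rewrite /ldim; case: xgetP => [_ -> [c [cfree spanc]]|/(_ n)]; last first.
  by case; exists b.
have Uc i : U (c i) by rewrite -spanc; apply: lspan_sub; exists i.
split=> [|m d dfree Ud]; first exact: bndU cfree Uc.
rewrite -(card_ord (xget _ _)).
by apply: (lin_indep_leq_card dfree (g := c)) => i; rewrite spanc.
Qed.

End Span.

Lemma lspan_bilin (K : fieldType) (V1 V2 W : lmodType K) (B : V1 -> V2 -> W)
    (S1 : set V1) (S2 : set V2) (S : set W) :
  (forall v, linear (fun u => B u v)) -> (forall u, linear (B u)) ->
  (forall u v, S1 u -> S2 v -> lspan S (B u v)) ->
  forall u v, lspan S1 u -> lspan S2 v -> lspan S (B u v).
Proof.
move=> Bl Br BS u v S1u S2v.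
have B0l w : B 0 w = 0.
  by have := Bl w (-1) 0 0; rewrite scaler0 addr0 scaleN1r addNr.
have B0r w : B w 0 = 0.
  by have := Br w (-1) 0 0; rewrite scaler0 addr0 scaleN1r addNr.
have [T0 TD] := lspan_submod S.
apply: (lspan_min (U := fun u => lspan S (B u v))) S1u => [|x S1x].
  by split=> [|a x y]; rewrite ?B0l // Bl; apply: TD.
apply: (lspan_min (U := fun v => lspan S (B x v))) S2v => [|y S2y].
  by split=> [|a y z]; rewrite ?B0r // Br; apply: TD.
exact: BS.
Qed.

(** * The relatively free algebra as an algebra of functions *)

Lemma lie_eval_comp (K : fieldType) (X Y : Type) (L : lieAlgType K)
    (v : Y -> L) (w : X -> free_lie K Y) u :
  lie_eval v (lie_eval w u) = lie_eval (fun x => lie_eval v (w x)) u.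
Proof.
elim/fl_class_ind: u; elim=> [x||s IHs t IHt|a s IHs|s IHs t IHt].
- by rewrite !lie_eval_var.
- by rewrite !linear0.
- by rewrite fl_classD !linearD /= IHs IHt.
- by rewrite fl_classZ !linearZ /= IHs.
- by rewrite fl_class_br !lie_eval_br IHs IHt.
Qed.

Section GenericElements.
Variables (K : fieldType) (k : nat).
Local Notation coords := ('I_3 * 'I_k -> K).
Local Notation Lg := (sl2_grading K).

(** The value at [p] of the generic homogeneous elements: t_i h in degree 0 and
    a_i e + b_i f in degree 1. *)
Definition generic_elt (p : coords) (g : 'Z_2) (i : 'I_k) : sl2 K :=
  if g == 0 then p (0, i) *: sl2_h K
  else p (1, i) *: sl2_e K + p (2%R, i) *: sl2_f K.

Lemma generic_elt_homog p g i : Lg g (generic_elt p g i).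
Proof.
by rewrite /generic_elt /= /sl2_homog; case: ifP => _ /=; do ?eexists.
Qed.

Definition generic_var (p : coords) (x : k_var Lg k) : sl2 K :=
  generic_elt p (val x.1) x.2.

(** Every graded substitution of the variables is a specialization of the
    generic one: its coordinates in the basis h, e, f form a point [p]. *)
Lemma k_identitiesP u :
  k_identities (Lg := Lg) u <-> forall p, lie_eval (generic_var p) u = 0.
Proof.
rewrite /k_identities /mkset /= /graded_identities /mkset.
split=> [uT p|u0 v hv].
  pose v (x : 'Z_2 * nat) := oapp (generic_elt p x.1) 0 (insub x.2).
  have hv g i : Lg g (v (g, i)).
    rewrite /v /=; case: insubP => [j _ _|_] /=; first exact: generic_elt_homog.
    by case: (homog_submod (sl2_grading K) g).
  rewrite -[RHS](uT v hv) /k_incl lie_eval_comp; congr lie_eval.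
  by apply/funext => x; rewrite lie_eval_var /v /= valK.
pose p (x : 'I_3 * 'I_k) : K :=
  if x.1 == 0 then sl2_val (v (0, val x.2)) 0 0
  else if x.1 == 1 then sl2_val (v (1, val x.2)) 0 1
  else sl2_val (v (1, val x.2)) 1 0.
rewrite /k_incl lie_eval_comp -[RHS](u0 p); congr lie_eval.
apply/funext => -[[g hg] i]; rewrite lie_eval_var /generic_var /generic_elt /=.
case: (ord2P g) => -> /=; rewrite /p /=.
  have /sl2_homog0P[v01 v10] := hv 0 (val i).
  by apply: sl2_eqP; rewrite ?sl2_valZ /= !mxE /= ?subr0 ?mulr1 ?mulr0.
have /sl2_homog1P v00 := hv 1 (val i).
by apply: sl2_eqP; rewrite !(sl2_valD, sl2_valZ) /=;
  rewrite !mxE /= ?mulr1 ?mulr0 ?addr0 ?add0r.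
Qed.

(** By [k_identitiesP] the value does not depend on the representative chosen by
    [lie_lift]. *)
Definition rf_eval (u : rel_free Lg k) : coords -> sl2 K :=
  fun p => lie_eval (generic_var p) (lie_lift u).

Lemma rf_eval_proj u p : rf_eval (lie_proj (k_ideal Lg k) u) p =
  lie_eval (generic_var p) u.
Proof.
have /k_identitiesP/(_ p) := lie_projK (k_ideal Lg k) u.
by rewrite linearB /= => /subr0_eq.
Qed.

Lemma rf_eval_linear : linear rf_eval.
Proof.
move=> a; elim/lie_proj_ind => u; elim/lie_proj_ind => w.
by apply/funext => p; rewrite -linearP !fctE !rf_eval_proj linearP.
Qed.
HB.instance Definition _ :=
  GRing.isLinear.Build K (rel_free Lg k) (coords -> sl2 K) _ rf_eval
    rf_eval_linear.

Lemma rf_eval_br u w p :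
  rf_eval [lie u, w] p = [lie rf_eval u p, rf_eval w p].
Proof.
elim/lie_proj_ind: u => u; elim/lie_proj_ind: w => w.
by rewrite -lie_proj_br !rf_eval_proj lie_eval_br.
Qed.

Lemma rf_eval_inj u : rf_eval u = 0 -> u = 0.
Proof.
elim/lie_proj_ind: u => u u0; apply/lie_proj_eq0/k_identitiesP => p.
by rewrite -rf_eval_proj u0.
Qed.

Lemma grading_supp_all g : grading_supp Lg g.
Proof.
rewrite /grading_supp /mkset => supp0.
have hom0 x : Lg g x -> x = 0 by rewrite supp0.
case: (ord2P g) hom0 => -> hom0.
  have /(congr1 (fun x : sl2 K => sl2_val x 0 0)) : sl2_h K = 0.
    by apply: hom0; apply/sl2_homog0P; rewrite /= !mxE /= !subrr.
  by rewrite /= !mxE /= subr0 => /eqP; rewrite oner_eq0.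
have /(congr1 (fun x : sl2 K => sl2_val x 0 1)) : sl2_e K = 0.
  by apply: hom0; apply/sl2_homog1P; rewrite /= !mxE.
by rewrite /= !mxE /= => /eqP; rewrite oner_eq0.
Qed.

Definition gen (g : 'Z_2) (i : 'I_k) : rel_free Lg k :=
  lie_proj (k_ideal Lg k)
    (fl_var K (exist _ g (asboolT (@grading_supp_all g)), i)).

Lemma gen_in g i : rel_free_gens Lg k (gen g i).
Proof. by eexists. Qed.

Lemma rel_free_gensP u : rel_free_gens Lg k u -> exists g i, u = gen g i.
Proof.
move=> [[[g hg] i] _ <-]; exists g, i; rewrite /gen.
by congr (lie_proj _ (fl_var K (_, _))); exact: val_inj.
Qed.

Lemma rf_eval_gen g i p : rf_eval (gen g i) p = generic_elt p g i.
Proof. by rewrite rf_eval_proj lie_eval_var. Qed.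

End GenericElements.

(** * Upper bound on the growth *)

Section UpperBound.
Variables (K : fieldType) (k : nat).
Local Notation coord := ('I_3 * 'I_k)%type.
Local Notation coords := ('I_3 * 'I_k -> K).
Local Notation Lg := (sl2_grading K).

Definition sl2_basis (x : 'I_3) : sl2 K :=
  if x == 0 then sl2_h K else if x == 1 then sl2_e K else sl2_f K.

(** The weight of the torus on the basis vector of index [x], which is also its
    weight on the coordinates [p (x, i)]. *)
Definition weight (x : 'I_3) : int :=
  if x == 0 then 0 else if x == 1 then 1 else -1.

Lemma ord3P (x : 'I_3) : [\/ x = 0, x = 1 | x = 2%R].
Proof.
case: x => [[|[|[|//]]] ?]; [constructor 1|constructor 2|constructor 3];
  exact: val_inj.
Qed.

Lemma sl2_br_he : [lie sl2_h K, sl2_e K] = 2 *: sl2_e K.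
Proof.
by apply: sl2_eqP; rewrite ?sl2_valZ /= !mxE ?sum_ord2 !mxE /=; ring.
Qed.

Lemma sl2_br_hf : [lie sl2_h K, sl2_f K] = (-2) *: sl2_f K.
Proof.
by apply: sl2_eqP; rewrite ?sl2_valZ /= !mxE ?sum_ord2 !mxE /=; ring.
Qed.

Lemma sl2_br_ef : [lie sl2_e K, sl2_f K] = sl2_h K.
Proof.
by apply: sl2_eqP; rewrite ?sl2_valZ /= !mxE ?sum_ord2 !mxE /=; ring.
Qed.

(** The torus acts by automorphisms, so brackets add weights. The case of a
    zero coefficient is set apart because the sum of two weights may not be a
    weight, as for e and e. *)
Lemma sl2_basis_br x y : exists a z,
  [lie sl2_basis x, sl2_basis y] = a *: sl2_basis z /\
  (a != 0 -> weight z = weight x + weight y).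
Proof.
case: (ord3P x) => ->; case: (ord3P y) => ->; rewrite /sl2_basis /weight /=.
- by exists 0, 0; rewrite lie_brxx scale0r; split; rewrite ?eqxx /=.
- by exists 2, 1; rewrite sl2_br_he; split; rewrite ?eqxx /=.
- by exists (-2), 2%R; rewrite sl2_br_hf; split; rewrite ?eqxx /=.
- by exists (-2), 1; rewrite lie_brC sl2_br_he scaleNr; split; rewrite ?eqxx /=.
- by exists 0, 0; rewrite lie_brxx scale0r; split; rewrite ?eqxx /=.
- by exists 1, 0; rewrite sl2_br_ef scale1r; split; rewrite ?eqxx /=.
- by exists 2, 2%R; rewrite lie_brC sl2_br_hf scaleNr opprK; split;
    rewrite ?eqxx /=.
- by exists (-1), 0; rewrite lie_brC sl2_br_ef scaleN1r; split;
    rewrite ?eqxx /=.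
- by exists 0, 0; rewrite lie_brxx scale0r; split; rewrite ?eqxx /=.
Qed.

Definition charge (e : coord -> nat) : int := \sum_c weight c.1 *+ e c.

Definition monom (e : coord -> nat) (x : 'I_3) : coords -> sl2 K :=
  fun p => (\prod_c p c ^+ e c) *: sl2_basis x.

(** The products of a monomial of exponents at most [n] and a basis vector that
    are equivariant under the torus. *)
Definition balanced (n : nat) : set (coords -> sl2 K) :=
  [set phi | exists e x,
     [/\ forall c, (e c <= n)%N, charge e = weight x & phi = monom e x]].

Lemma balanced_br m n phi psi :
  lspan (balanced m) phi -> lspan (balanced n) psi ->
  lspan (balanced (m + n)) (fun p => [lie phi p, psi p]).
Proof.
apply: (lspan_bilin
  (B := fun phi psi : coords -> sl2 K => fun p => [lie phi p, psi p])).
- by move=> v a u w; apply/funext => p; rewrite !fctE lie_brDl lie_brZl.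
- by move=> u a v w; apply/funext => p; rewrite !fctE lie_brDr lie_brZr.
move=> _ _ [e [x [en ex ->]]] [d [y [dn dy ->]]].
have [a [z [xyE wz]]] := sl2_basis_br x y.
have -> : (fun p => [lie monom e x p, monom d y p]) =
    a *: monom (fun c => e c + d c)%N z.
  apply/funext => p; rewrite /monom fctE lie_brZl lie_brZr xyE !scalerA.
  rewrite mulrC -big_split; congr (_ * _ *: _); apply: eq_bigr => c _.
  by rewrite /= exprD.
have [B0 BD] := lspan_submod (balanced (m + n)).
have [->|a0] := eqVneq a 0; first by rewrite scale0r.
rewrite -[X in lspan _ X]addr0; apply: BD => //; apply: lspan_sub.
exists (fun c => e c + d c)%N, z; split=> // [c|]; first exact: leq_add.
rewrite wz // -ex -dy /charge -big_split; apply: eq_bigr => c _.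
by rewrite mulrnDr.
Qed.

Lemma coord_balanced x i :
  balanced 1 (fun p : coords => p (x, i) *: sl2_basis x).
Proof.
exists (fun c => (c == (x, i)) : nat), x; split=> [c||].
- exact: leq_b1.
- rewrite /charge (bigD1 (x, i)) //= eqxx mulr1n big1 ?addr0 // => c /negPf->.
  by rewrite mulr0n.
apply/funext => p; rewrite /monom (bigD1 (x, i)) //= eqxx expr1.
by rewrite big1 /= ?mulr1 // => c /negPf->.
Qed.

Lemma gen_balanced g i : lspan (balanced 1) (rf_eval (gen K g i)).
Proof.
rewrite (_ : rf_eval _ = fun p => generic_elt p g i); last first.
  by apply/funext => p; rewrite rf_eval_gen.
rewrite /generic_elt; case: (g == 0); first exact/lspan_sub/(coord_balanced 0).
have [_ BD] := lspan_submod (balanced 1).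
have := BD 1 _ _ (lspan_sub (coord_balanced 1 i))
  (lspan_sub (coord_balanced 2%R i)).
congr lspan; apply/funext => p; by rewrite !fctE scale1r.
Qed.

Lemma word_balanced n w : word_length (rel_free_gens Lg k) n w ->
  lspan (balanced n) (rf_eval w).
Proof.
elim=> [x /rel_free_gensP[g [i ->]]|m {}n x y _ IHx _ IHy].
  exact: gen_balanced.
rewrite (_ : rf_eval _ = fun p => [lie rf_eval x p, rf_eval y p]).
  exact: balanced_br.
by apply/funext => p; rewrite rf_eval_br.
Qed.

Lemma balanced_mono m n phi : (m <= n)%N -> balanced m phi -> balanced n phi.
Proof.
move=> mn [e [x [em ex ->]]]; exists e, x; split=> // c.
exact: leq_trans mn.
Qed.

Variable i0 : 'I_k.

Definition exponents m : finType := {xe : 'I_3 * {ffun coord -> 'I_m.+1} |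
  charge (fun c => xe.2 c) == weight xe.1}.

(** The exponent of the coordinate (1, i0), whose weight is 1, is determined by
    the other exponents and the weight equation. *)
Lemma card_exponents m : (#|exponents m| <= 3 * m.+1 ^ (3 * k - 1))%N.
Proof.
pose c0 : coord := (1, i0).
pose f (xe : exponents m) := ((val xe).1,
  [ffun c : {c : coord | c != c0} => (val xe).2 (val c)]).
have inj_f : injective f.
  move=> [[x e] he] [[y d] hd] [xy]; move: hd; rewrite -{}xy => hd.
  move=> /ffunP ed; apply: val_inj => /=; congr (_, _); apply/ffunP => c.
  have ed' c' : c' != c0 -> e c' = d c'.
    by move=> nc'; have := ed (exist _ c' nc'); rewrite !ffunE.
  have [->|/ed'//] := eqVneq c c0; apply/val_inj.
  move: (eqP he); rewrite -(eqP hd) /charge (bigD1 c0) //= [RHS](bigD1 c0) //=.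
  rewrite (eq_bigr (fun c => weight c.1 *+ d c)) => [|c' /ed'-> //].
  by move/addIr; rewrite !natz => -[].
apply: leq_trans (leq_card f inj_f) _.
rewrite card_prod card_ord card_ffun card_ord leq_mul2l /= card_sig.
have -> : #|[pred c | c != c0]| = (3 * k - 1)%N.
  by rewrite (cardC1 c0) card_prod !card_ord subn1.
by rewrite leqnn.
Qed.

Definition word_upto n : set (rel_free Lg k) :=
  [set w | exists2 l, (l <= n)%N &
     word_length (rel_free_gens Lg k) l w]%classic.

Lemma lin_indep_word_bound m n (b : 'I_n -> rel_free Lg k) :
  lin_indep b ->
  (forall i, lspan (word_upto m) (b i)) ->
  (n <= 3 * m.+1 ^ (3 * k - 1))%N.
Proof.
move=> bfree bw; apply: leq_trans (card_exponents m).
pose g (xe : exponents m) := monom (fun c => (val xe).2 c) (val xe).1.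
have rfree := lin_indep_map (f := @rf_eval K k) (@rf_eval_inj K k) bfree.
have := lin_indep_leq_card rfree (g := g); apply => i /=.
have [S0 SD] := lspan_submod (range g).
apply: (lspan_min (U := fun u => lspan (range g) (rf_eval u))) (bw i).
  by split=> [|a u v]; rewrite ?linear0 ?linearP //; apply: SD.
move=> w [l lm /word_balanced]; apply: lspan_mono => phi /(balanced_mono lm).
case=> e [x [em ex ->]].
have he : charge (fun c => [ffun c => inord (e c) : 'I_m.+1] c) = charge e.
  by apply: eq_bigr => c _; rewrite ffunE inordK // ltnS.
exists (exist _ (x, [ffun c => inord (e c)]) (introT eqP (etrans he ex))) => //.
apply/funext => p; rewrite /g /monom /=; congr (_ *: _); apply: eq_bigr => c _.
by rewrite ffunE inordK // ltnS.
Qed.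

End UpperBound.

(** * Lower bound on the growth *)

Lemma sum_digits s r N :
  (\sum_(i < r) (N %/ s ^ i %% s) * s ^ i = N %% s ^ r)%N.
Proof.
elim: r => [|r IHr]; first by rewrite big_ord0 expn0 modn1.
rewrite big_ord_recr /= IHr expnS.
rewrite modn_divl -(modn_dvdm N (dvdn_mull s (dvdnn (s ^ r)))) addnC.
by rewrite -divn_eq.
Qed.

(** Apply the [i]-th step [d i] times, for each [i].  In the applications,
    [Q n M] says that some word of length at most [n] has a value of the form
    c x^M, and stating it for the existence of such words avoids writing down
    the iterated brackets. *)
Lemma iterate_steps (Q : nat -> nat -> Prop) (r cost : nat)
    (wt d : nat -> nat) :
  (forall i n M, (i < r)%N -> Q n M -> Q (n + cost)%N (M + wt i)%N) ->
  forall n M, Q n M ->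
  Q (n + cost * \sum_(i < r) d i)%N (M + \sum_(i < r) d i * wt i)%N.
Proof.
elim: r => [|r IHr] step n M QnM; first by rewrite !big_ord0 muln0 !addn0.
have : Q (n + cost * \sum_(i < r) d i)%N (M + \sum_(i < r) d i * wt i)%N.
  by apply: IHr QnM => i n' M' ir; apply: step; exact: ltnW.
rewrite !big_ord_recr /= mulnDr !addnA.
set n' := (n + _)%N; set M' := (M + _)%N => Qn'M'.
elim: (d r) => [|c IHc]; first by rewrite muln0 mul0n !addn0.
have := step r _ _ (ltnSn r) IHc.
by congr (Q _ _); [rewrite mulnS|rewrite mulSn]; lia.
Qed.

Section CharacteristicZero.
Variables (K : fieldType) (charK0 : [pchar K] =i pred0).

Lemma natr_inj_char0 : injective (fun n => n%:R : K).
Proof.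
move/pcharf0P: charK0 => nat0 m n /= mn.
wlog le_mn : m n mn / (m <= n)%N.
  by move=> H; case: (leqP m n) => [|/ltnW] /H ->.
apply/eqP; rewrite eqn_leq le_mn -subn_eq0 -nat0 natrB // mn subrr.
by rewrite eqxx.
Qed.

(** The values 1, 2, 3, ... are too many roots for a nonzero polynomial. *)
Lemma powers_indep n (c : 'I_n -> K) :
  (forall x : K, x != 0 -> \sum_i c i * x ^+ i = 0) -> forall i, c i = 0.
Proof.
move=> c0 i.
pose q := \poly_(j < n) (oapp c 0 (insub j)).
have qE x : q.[x] = \sum_i c i * x ^+ i.
  by rewrite horner_poly; apply: eq_bigr => j _; rewrite valK.
suff q0 : q = 0.
  have := congr1 (fun p : {poly K} => p`_i) q0.
  by rewrite coef_poly ltn_ord valK coef0.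
apply/eqP; apply: contraT => nq0.
have := @max_poly_roots _ q [seq j.+1%:R | j <- iota 0 (size q)] nq0.
rewrite size_map size_iota ltnn; apply.
  apply/allP => _ /mapP[j _ ->]; rewrite rootE qE c0 //.
  by move/pcharf0P: charK0 => ->.
rewrite map_inj_uniq ?iota_uniq // => j j' /natr_inj_char0; exact: succn_inj.
Qed.

Lemma sl2_br_odd_even (a b c : K) :
  [lie a *: sl2_e K + b *: sl2_f K, c *: sl2_h K] =
  (- 2 * a * c) *: sl2_e K + (2 * b * c) *: sl2_f K.
Proof.
by apply: sl2_eqP; rewrite ?(sl2_valD, sl2_valZ) /= !(mxE, sum_ord2) /=; ring.
Qed.

Lemma sl2_br_even_odd (a b c : K) :
  [lie c *: sl2_h K, a *: sl2_e K + b *: sl2_f K] =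
  (2 * c * a) *: sl2_e K + (- 2 * c * b) *: sl2_f K.
Proof.
by apply: sl2_eqP; rewrite ?(sl2_valD, sl2_valZ) /= !(mxE, sum_ord2) /=; ring.
Qed.

Lemma sl2_br_odd_odd (a b a' b' : K) :
  [lie a *: sl2_e K + b *: sl2_f K, a' *: sl2_e K + b' *: sl2_f K] =
  (a * b' - b * a') *: sl2_h K.
Proof.
by apply: sl2_eqP; rewrite ?(sl2_valD, sl2_valZ) /= !(mxE, sum_ord2) /=; ring.
Qed.

Lemma sl2_br_zzh (a b a' b' c : K) :
  [lie a *: sl2_e K + b *: sl2_f K,
    [lie a' *: sl2_e K + b' *: sl2_f K, c *: sl2_h K]] =
  (c * (2 * (a * b' + b * a'))) *: sl2_h K.
Proof.
by rewrite sl2_br_odd_even sl2_br_odd_odd; congr (_ *: _); ring.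
Qed.

Lemma sl2_br_zyzh (a b a' b' t c : K) :
  [lie a *: sl2_e K + b *: sl2_f K, [lie t *: sl2_h K,
    [lie a' *: sl2_e K + b' *: sl2_f K, c *: sl2_h K]]] =
  (c * (- 4 * t * (a * b' - b * a'))) *: sl2_h K.
Proof.
rewrite sl2_br_odd_even sl2_br_even_odd sl2_br_odd_odd.
by congr (_ *: _); ring.
Qed.

Lemma sl2_br_h01 (t : K) (u : sl2 K) :
  sl2_val [lie t *: sl2_h K, u] 0 1 = 2 * t * sl2_val u 0 1.
Proof. by rewrite /= !(mxE, sum_ord2) /=; ring. Qed.

Variables (k' s : nat).
Hypothesis s_gt0 : (0 < s)%N.
Local Notation k := k'.+1.
Local Notation D := (3 * k'.+1 - 1)%N.
Local Notation coords := ('I_3 * 'I_k -> K).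
Local Notation Lg := (sl2_grading K).

Lemma two_neq0 : (2 : K) != 0.
Proof. by move/pcharf0P: charK0 => ->. Qed.

(** The multipliers are numbered as in [odd_word_digits]: [X i] is that of the
    bracket with y_i, [X (k + j)] that of [z_0, [z_j, -]] and
    [X (k + (k + j.-1))] that of [z_0, [y_0, [z_j, -]]]. *)
Definition multipliers_at (X : nat -> K) (p : coords) : Prop :=
  [/\ forall i : 'I_k, 2 * p (0, i) = X i,
      p (1, ord0) = 1,
      forall j : 'I_k,
        2 * (p (1, ord0) * p (2%R, j) + p (2%R, ord0) * p (1, j)) =
        X (k + j)%N &
      forall j : 'I_k, j != ord0 ->
        - 4 * p (0, ord0) *
          (p (1, ord0) * p (2%R, j) - p (2%R, ord0) * p (1, j)) =
        X (k + (k + j.-1))%N].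

(** With a_0 = 1 the system is triangular: the first family of equations gives
    t_i, the second one at j = 0 gives b_0, and for each other j a linear system
    remains for the pair (b_j, b_0 a_j), solved by (U j - V j, U j + V j)
    below. *)
Lemma point_with_multipliers (X : nat -> K) :
  (forall i, X i != 0) -> exists p, multipliers_at X p.
Proof.
move=> X0; have n2 := two_neq0; have nX0 := X0 0%N; have nXk := X0 k.
pose U (j : 'I_k) := X (k + j)%N / 4.
pose V (j : 'I_k) := X (k + (k + j.-1))%N / (4 * X 0%N).
have n4 : (4 : K) != 0 by move/pcharf0P: charK0 => ->.
exists (fun c : 'I_3 * 'I_k => if c.1 == 0 then X c.2 / 2
  else if c.1 == 1 then (if c.2 == ord0 then 1 else (U c.2 + V c.2) / (X k / 4))
  else (if c.2 == ord0 then X k / 4 else U c.2 - V c.2)).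
split=> [i||j|j /negPf nj0] /=; first by field.
- by [].
- case: (eqVneq j ord0) => [->|_] /=; first by rewrite addn0; field.
  by rewrite /U /V; field; rewrite nX0 nXk n4.
rewrite nj0 /U /V; field; by rewrite nX0 nXk n4 n2.
Qed.

(** Kronecker substitution: powers of a single [x] whose exponents are the place
    values in base [s]. *)
Lemma kronecker_points : exists P : K -> coords,
  forall x : K, x != 0 -> multipliers_at (fun i => x ^+ (s ^ i)) (P x).
Proof.
have pt x : exists p, x != 0 -> multipliers_at (fun i => x ^+ (s ^ i)) p.
  have [->|x0] := eqVneq x 0; first by exists (fun=> 0).
  have [i|p hp] := @point_with_multipliers (fun i => x ^+ (s ^ i)).
    by rewrite expf_neq0.
  by exists p.
by have [P PE] := choice pt; exists P.
Qed.

Variable P : K -> coords.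
Hypothesis PE : forall x : K, x != 0 ->
  multipliers_at (fun i => x ^+ (s ^ i)) (P x).

Lemma word_upto_gen g i : word_upto 1 (gen K (k := k) g i).
Proof. by exists 1%N => //; exact/word_gen/gen_in. Qed.

Lemma word_upto_br m n (u w : rel_free Lg k) : word_upto m u -> word_upto n w ->
  word_upto (m + n) [lie u, w].
Proof.
move=> [l lm ul] [l' ln wl]; exists (l + l')%N; first exact: leq_add.
exact: word_br.
Qed.

Lemma word_upto_mono m n (w : rel_free Lg k) :
  (m <= n)%N -> word_upto m w -> word_upto n w.
Proof. by move=> mn [l lm wl]; exists l => //; exact: leq_trans mn. Qed.

Local Notation y := (@gen K k 0).
Local Notation z := (@gen K k 1).

Lemma rf_eval_y i p : rf_eval (y i) p = p (0, i) *: sl2_h K.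
Proof. by rewrite rf_eval_gen. Qed.

Lemma rf_eval_z i p :
  rf_eval (z i) p = p (1, i) *: sl2_e K + p (2%R, i) *: sl2_f K.
Proof. by rewrite rf_eval_gen. Qed.

(** The factor 1/2 makes y_0 = t_0 h itself such a word, since 2 t_0 = x, and it
    cancels when passing to [odd_word]. *)
Definition even_word n M := exists2 w, word_upto n w &
  forall x : K, x != 0 -> rf_eval w (P x) = (x ^+ M / 2) *: sl2_h K.

Definition odd_word n M := exists2 w, word_upto n w &
  forall x : K, x != 0 -> sl2_val (rf_eval w (P x)) 0 1 = x ^+ M.

Lemma even_word_step r n M : (r < k + k')%N ->
  even_word n M -> even_word (n + 3) (M + s ^ (k + r)).
Proof.
move=> rk [w wn wE]; have [ltrk|lekr] := ltnP r k.
  exists [lie z ord0, [lie z (Ordinal ltrk), w]].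
    apply: (word_upto_mono (m := 1 + (1 + n))); first by lia.
    by do ![exact: word_upto_gen | apply: word_upto_br].
  move=> x x0; have [_ _ /(_ (Ordinal ltrk)) /= hD _] := PE x0.
  rewrite !rf_eval_br !rf_eval_z wE // sl2_br_zzh hD exprD; congr (_ *: _).
  by rewrite mulrAC.
have jk : ((r - k).+1 < k)%N by lia.
pose j := Ordinal jk.
exists [lie z ord0, [lie y ord0, [lie z j, w]]].
  apply: (word_upto_mono (m := 1 + (1 + (1 + n)))); first by lia.
  by do ![exact: word_upto_gen | apply: word_upto_br].
move=> x x0; have [_ _ _ /(_ j isT) /=] := PE x0.
rewrite subnKC // => hE.
rewrite !rf_eval_br !rf_eval_z rf_eval_y wE // sl2_br_zyzh hE exprD.
by congr (_ *: _); rewrite mulrAC.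
Qed.

Lemma odd_word_step i n M : (i < k)%N ->
  odd_word n M -> odd_word (n + 3) (M + s ^ i).
Proof.
move=> ik [w wn wE]; exists [lie y (Ordinal ik), w].
  apply: (word_upto_mono (m := 1 + n)); first by lia.
  by apply: word_upto_br => //; exact: word_upto_gen.
move=> x x0; have [/(_ (Ordinal ik)) /= hT _ _ _] := PE x0.
by rewrite rf_eval_br rf_eval_y sl2_br_h01 wE // hT exprD mulrC.
Qed.

Lemma even_word1 : even_word 1 1.
Proof.
exists (y ord0) => [|x x0]; first exact: word_upto_gen.
have [/(_ ord0) hT _ _ _] := PE x0.
rewrite rf_eval_y; congr (_ *: _); move: hT; rewrite expn0 => <-.
by rewrite mulrC mulKf ?two_neq0.
Qed.

Lemma even_word_odd n M : even_word n M -> odd_word n.+1 M.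
Proof.
move=> [w wn wE]; exists [lie w, z ord0].
  by rewrite -(addn1 n); apply: word_upto_br => //; exact: word_upto_gen.
move=> x x0; have [_ a0 _ _] := PE x0.
rewrite rf_eval_br wE // sl2_br_h01 rf_eval_z a0 /= !mxE /=.
by field; exact: two_neq0.
Qed.

(** The operator with the [i]-th multiplier is applied as often as the [i]-th
    digit of [N] says, so that the exponents [s ^ i] add up to [N]; the initial
    y_0 and the bracket with z_0 that passes from even to odd elements
    contribute 2 to the length and one factor x, which is 2 t_0. *)
Lemma odd_word_digits N : (N < s ^ D)%N -> odd_word (2 + 3 * (D * s)) N.+1.
Proof.
move=> Ns; pose d i := (N %/ s ^ i %% s)%N.
have := even_word1 => /(iterate_steps (fun r => d (k + r)%N) even_word_step).
move=> /even_word_odd /(iterate_steps d odd_word_step) [w wn wE].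
exists w.
  apply: word_upto_mono wn.
  have bd r (f : nat -> nat) : (\sum_(i < r) d (f i) <= r * s)%N.
    rewrite -[X in (_ <= X * _)%N]card_ord -sum_nat_const.
    apply: leq_sum => i _; by rewrite ltnW // ltn_mod.
  have := bd k id; have := bd (k + k')%N (addn k); nia.
move=> x /wE->; congr (_ ^+ _).
rewrite add1n addSn; congr _.+1; rewrite addnC.
rewrite -[RHS](modn_small Ns) -sum_digits (_ : D = k + (k + k'))%N; last by lia.
by rewrite [RHS]big_split_ord.
Qed.

Lemma lin_indep_words m : (2 + 3 * (D * s) <= m)%N ->
  exists b : 'I_(s ^ D) -> rel_free Lg k,
    lin_indep b /\ forall i, word_upto m (b i).
Proof.
move=> ms.
have [b bE] := choice (P := fun (N : 'I_(s ^ D)) w => word_upto m w /\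
  forall x : K, x != 0 -> sl2_val (rf_eval w (P x)) 0 1 = x ^+ N.+1)
  (fun N => let: ex_intro2 w wn wE := odd_word_digits (ltn_ord N) in
    ex_intro _ w (conj (word_upto_mono ms wn) wE)).
exists b; split=> [c sum0|i]; last by case: (bE i).
apply: powers_indep => x x0; apply: (mulfI x0); rewrite mulr0 mulr_sumr.
have := congr1 (fun u => \val (rf_eval u (P x)) 0 1) sum0.
rewrite linear_sum linear0 fct_sumE raddf_sum summxE /= mxE => sum1.
rewrite -[RHS]sum1.
apply: eq_bigr => i _; have [_ /(_ x x0) bx] := bE i.
by rewrite linearZ /= mxE bx exprS mulrCA.
Qed.

End CharacteristicZero.

(** * Polynomial growth and logarithmic limits *)

Section PolynomialGrowth.
Import numFieldNormedType.Exports.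
Local Open Scope classical_set_scope.

Lemma cvg_ln_pinfty (R : realType) : (ln (m%:R : R)) @[m --> \oo] --> +oo.
Proof.
apply/cvgryPge => A; near=> m.
have Am : expR A <= m%:R by near: m; exact: nbhs_infty_ger.
by rewrite -(expRK A) ler_ln ?posrE ?expR_gt0 // (lt_le_trans (expR_gt0 A)).
Unshelve. all: by end_near. Qed.

(** By monotonicity of ln, ln (g m) / ln m differs from [D] by at most
    ln C / ln m. *)
Lemma limsup_log_growth (R : realType) (g : nat -> nat) (C D : nat) :
  (\forall m \near \oo, (m ^ D <= C * g m)%N /\ (g m <= C * m ^ D)%N) ->
  limn_esup (fun m => (ln (g m)%:R / ln m%:R : R)%:E) = D%:R%:E.
Proof.
move=> gD.
suff : (ln (g m)%:R / ln m%:R : R) @[m --> \oo] --> (D%:R : R).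
  move=> gl; apply: (cvg_limn_einf_sup _).2.
  by apply: cvg_EFin => //; exact: nearW.
have lnV0 : ((ln (m%:R : R))^-1) @[m --> \oo] --> (0 : R).
  apply/gtr0_cvgV0; last exact: cvg_ln_pinfty.
  near=> m; rewrite ln_gt0 // ltr1n; near: m; exact: nbhs_infty_gt.
apply: (@squeeze_cvgr _ _ _ _
  (fun m => D%:R - ln (C%:R : R) * (ln (m%:R : R))^-1)
  (fun m => D%:R + ln (C%:R : R) * (ln (m%:R : R))^-1)).
- near=> m.
  have m1 : (1 < m)%N by near: m; exact: nbhs_infty_gt.
  have [lo up] : (m ^ D <= C * g m)%N /\ (g m <= C * m ^ D)%N by near: m.
  have mD0 : (0 < m ^ D)%N by rewrite expn_gt0 ltnW.
  have /andP[C0 g0] : (0 < C)%N && (0 < g m)%N.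
    by rewrite -muln_gt0; exact: leq_trans lo.
  have lnm : 0 < ln (m%:R : R) by rewrite ln_gt0 // ltr1n.
  have lnD : ln ((m ^ D)%N%:R : R) = D%:R * ln m%:R.
    by rewrite natrX lnXn ?mulr_natl // ltr0n ltnW.
  rewrite ler_pdivlMr // ler_pdivrMr //.
  rewrite !mulrDl mulNr -!mulrA mulVf ?gt_eqF // !mulr1.
  rewrite lerBlDr -lnD -!lnM ?posrE ?ltr0n // -!natrM.
  rewrite !ler_ln ?posrE ?ltr0n ?muln_gt0 ?C0 ?g0 ?mD0 // !ler_nat.
  by rewrite mulnC lo mulnC up.
- rewrite -[X in _ --> X]subr0 -(mulr0 (ln C%:R)).
  by apply: cvgB; [exact: cvg_cst|apply: cvgMr].
- rewrite -[X in _ --> X]addr0 -(mulr0 (ln C%:R)).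
  by apply: cvgD; [exact: cvg_cst|apply: cvgMr].
Unshelve. all: by end_near. Qed.

End PolynomialGrowth.

(** * The Gelfand-Kirillov dimension *)

Lemma sl2_growth_bounds (K : fieldType) (charK0 : [pchar K] =i pred0)
    (k' m : nat) :
  let D := (3 * k'.+1 - 1)%N in
  let g := growth (rel_free_gens (sl2_grading K) k'.+1) m in
  (g <= 3 * m.+1 ^ D)%N /\
  forall s, (0 < s)%N -> (2 + 3 * (D * s) <= m)%N -> (s ^ D <= g)%N.
Proof.
have [up lo] := ldim_bounds (lspan_submod _)
  (@lin_indep_word_bound K k'.+1 ord0 m).
split=> [|s s0 sm]; first exact: up.
have [P PE] := kronecker_points charK0 k' s.
have [b [bfree bw]] := lin_indep_words charK0 s0 PE sm.
apply: (lo _ _ bfree) => i; apply: lspan_sub; exact: bw.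
Qed.

Theorem corollary3p3 (R : realType) (K : fieldType)
    (charK0 : [pchar K] =i pred0) (k : nat) (k_ge1 : (1 <= k)%N) :
  graded_GKdim R (sl2_grading K) k = (3 * k%:R - 1)%:E.
Proof.
case: k k_ge1 => // k' _; pose D := (3 * k'.+1 - 1)%N.
have -> : 3 * k'.+1%:R - 1 = D%:R :> R by rewrite natrB // natrM.
have D0 : (0 < D)%N by rewrite /D; lia.
(* The largest s with 2 + 3 D s <= m satisfies m <= 6 D s, and
   3 (m + 1)^D <= 3 (2 m)^D; the constant 3 (6 D)^D covers both bounds. *)
apply: (@limsup_log_growth _ _ (3 * (6 * D) ^ D)).
exists (6 * D + 2)%N => // m /= mD.
have [up lo] := sl2_growth_bounds charK0 k' m; split.
  pose s := ((m - 2) %/ (3 * D))%N.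
  have dm := divn_eq (m - 2) (3 * D); have rm := @ltn_pmod (m - 2) (3 * D).
  have ms : (m <= 6 * D * s)%N by move: dm rm; rewrite -/s => dm rm; nia.
  have s0 : (0 < s)%N by rewrite lt0n; apply: contraTneq ms => ->; lia.
  have {lo} : (s ^ D <= growth (rel_free_gens (sl2_grading K) k'.+1) m)%N.
    by apply: lo => //; rewrite mulnA -/D; move: dm; rewrite -/s; lia.
  move=> lo; apply: (@leq_trans ((6 * D * s) ^ D)); first by rewrite leq_exp2r.
  rewrite expnMn; apply: leq_mul => //; exact: leq_pmull.
apply: leq_trans up _; rewrite -mulnA leq_mul2l /= -expnMn leq_exp2r //.
by move: mD; nia.
Qed.
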